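(* Let $m$ be a positive integer and $q=2^m$. Then $$f(x)=x^2+x^{2q^2+2q-2}+x^{2q^3+2q^2-2q}+x^{q^2-q+1}+x^{q^3-q^2+q}$$ is a permutation polynomial over $\mathbb{F}_{q^3}$ if and only if $m\not\equiv 2\pmod 3$.
   Context: $\mathbb{F}_{q^3}$ denotes the finite field with $q^3$ elements. A polynomial $f\in\mathbb{F}_{q^3}[x]$ is a permutation polynomial over $\mathbb{F}_{q^3}$ if the associated map $c\mapsto f(c)$ from $\mathbb{F}_{q^3}$ to itself is a bijection. *)

(* Defs.v *)
From mathcomp Require Import all_boot all_algebra.
Set Implicit Arguments.
Unset Strict Implicit.
Unset Printing Implicit Defensive.
Import GRing.Theory.
Local Open Scope ring_scope.

Definition permutation_poly (F : finFieldType) (f : {poly F}) : Prop :=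
  bijective (fun c : F => f.[c]).

(* The exponents are natural numbers; none of the truncated subtractions
   truncates once 1 <= q. *)
Definition pentanomial (F : finFieldType) (q : nat) : {poly F} :=
  'X^2
  + 'X^(2 * q ^ 2 + 2 * q - 2)
  + 'X^(2 * q ^ 3 + 2 * q ^ 2 - 2 * q)
  + 'X^(q ^ 2 - q + 1)
  + 'X^(q ^ 3 - q ^ 2 + q).

(* Main.v *)
(* Put y = x^q, z = x^(q^2) and u = xz/y.  Then x^2 = u u^q, so x |-> u is
   injective, and f(x) = g(u) with g(u) = u u^q + u^(2q^2) + u^2 + u + u^q.
   If g(v + d) = g(v), weighting the conjugates of this equation eliminates v
   and leaves the cubic form of d, e = d^q, h = d^(q^2)
     d^3 + e^3 + h^3 + d^2 h + e^2 d + h^2 e + d e h = 0,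
   which splits over F_8 into three conjugate linear factors
   h + r^2 d + r^3 e with r^3 + r + 1 = 0.  Applying Frobenius to such a factor
   gives a linear system in d, e, h, nonsingular when r^q is r or r^2, that is
   when m is 0 or 1 mod 3.  When m = 2 mod 3, f is not injective on F_8. *)

Require Import Defs.
From mathcomp Require Import all_boot all_algebra.
From mathcomp Require Import all_fingroup all_solvable all_field ring zify.
Set Implicit Arguments.
Unset Strict Implicit.
Unset Printing Implicit Defensive.
Import GRing.Theory.
Local Open Scope ring_scope.

(** * Roots of X^3 + X + 1 in characteristic 2 *)

(** [ring] cannot use 2 = 0, so identities of characteristic 2 are stated with an explicit term
    [2 * K], which this discards. *)
Lemma char2_add_double (F : fieldType) (A B K : F) :
  2 \in [pchar F] -> A = B + 2 * K -> A = B.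
Proof. by move=> /pcharf0 -> ->; rewrite mul0r addr0. Qed.

Lemma expr7_of_cubic (F : fieldType) (r : F) :
  2 \in [pchar F] -> r ^+ 3 + r + 1 = 0 -> r ^+ 7 = 1.
Proof.
move=> F2 r3; apply: (char2_add_double (K := r ^+ 3 - r ^+ 4) F2).
have -> : r ^+ 7 = (r - 1) * (r ^+ 3 + r ^+ 2 + 1) * (r ^+ 3 + r + 1)
                   + 1 + 2 * (r ^+ 3 - r ^+ 4) by ring.
by rewrite r3 mulr0 add0r.
Qed.

Lemma cubic_root_square (F : fieldType) (r : F) :
  2 \in [pchar F] -> r ^+ 3 + r + 1 = 0 -> (r ^+ 2) ^+ 3 + r ^+ 2 + 1 = 0.
Proof.
move=> F2 r3; apply: (char2_add_double (K := - (r ^+ 4 + r ^+ 3 + r)) F2).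
have -> : (r ^+ 2) ^+ 3 + r ^+ 2 + 1
          = (r ^+ 3 + r + 1) ^+ 2 - 2 * (r ^+ 4 + r ^+ 3 + r) by ring.
by rewrite r3; ring.
Qed.

Lemma cubic_root_neq (F : fieldType) (r : F) :
  2 \in [pchar F] -> r ^+ 3 + r + 1 = 0 -> r != 0 /\ r != 1.
Proof.
move=> F2 r3; split; apply/eqP=> r_eq; move: r3; rewrite r_eq.
  by rewrite expr0n /= !add0r => /eqP; rewrite oner_eq0.
have -> : 1 ^+ 3 + 1 + 1 = 1 + 2 * 1 :> F by ring.
by rewrite (pcharf0 F2) mul0r addr0 => /eqP; rewrite oner_eq0.
Qed.

(* In characteristic 2, X^7 - 1 = (X - 1)(X^3 + X + 1)(X^3 + X^2 + 1), and the
   last two factors are reciprocal. *)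
Lemma cubic_root_exists (F : finFieldType) (m : nat) :
  2 \in [pchar F] -> #|F| = ((2 ^ m) ^ 3)%N ->
  exists r : F, r ^+ 3 + r + 1 = 0.
Proof.
move=> F2 cardF.
(* The unit group has order 8^m - 1, a multiple of 7. *)
have dvd7 : (7 %| #|[set: {unit F}]|)%N.
  by rewrite card_finField_unit cardF -expnM mulnC expnM (dvdn_pred_predX 8).
have [u _ ou] := Cauchy (isT : prime 7) dvd7.
set x : F := val u.
have x7 : x ^+ 7 = 1.
  by rewrite -FinRing.val_unitX -ou expg_order FinRing.val_unit1.
have x_neq1 : x != 1.
  apply/eqP=> x1; have : u = 1%g by apply: val_inj; rewrite FinRing.val_unit1.
  by move=> u1; move: ou; rewrite u1 order1.
have : (x - 1) * ((x ^+ 3 + x + 1) * (x ^+ 3 + x ^+ 2 + 1)) = 0.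
  apply: (char2_add_double (K := x ^+ 4 - x ^+ 3) F2).
  by rewrite add0r -[RHS]add0r -(subrr (x ^+ 7)) {2}x7; ring.
move/eqP; rewrite !mulf_eq0 subr_eq0 (negbTE x_neq1) /=.
case/orP=> /eqP x3; first by exists x.
(* Since x^7 = 1, x^6 is the inverse of x, hence a root of the reciprocal factor. *)
exists (x ^+ 6).
have -> : (x ^+ 6) ^+ 3 + x ^+ 6 + 1
  = (x ^+ 7) ^+ 2 * x ^+ 4 + x ^+ 6 + 1 by ring.
rewrite x7 -x7.
have -> : (x ^+ 7) ^+ 2 * x ^+ 4 + x ^+ 6 + x ^+ 7
  = x ^+ 4 * (x ^+ 3 + x ^+ 2 + 1) + ((x ^+ 7) ^+ 2 - 1) * x ^+ 4 by ring.
by rewrite x3 x7; ring.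
Qed.

(** * The cubic form and the quadratic map *)

Definition cyclic_cubic (R : comNzRingType) (d e h : R) : R :=
  d ^+ 3 + e ^+ 3 + h ^+ 3 + d ^+ 2 * h + e ^+ 2 * d + h ^+ 2 * e + d * e * h.

(* With a, b, c the conjugates of a root of X^3 + X + 1, the linear factors
   are h + b d + ab e and its images under the cyclic permutation of a, b, c. *)
Lemma cyclic_cubic_factor (F : fieldType) (a d e h : F) :
  2 \in [pchar F] -> a ^+ 3 + a + 1 = 0 ->
  cyclic_cubic d e h =
    (h + a ^+ 2 * d + a ^+ 3 * e)
    * (h + (a ^+ 2) ^+ 2 * d + (a ^+ 2) ^+ 3 * e)
    * (h + (a ^+ 4) ^+ 2 * d + (a ^+ 4) ^+ 3 * e).
Proof.
move=> F2 a3; have a7 := expr7_of_cubic F2 a3.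
set b := a ^+ 2; set c := a ^+ 4.
have s1 : a + b + c = 0.
  by rewrite /b /c -(mulr0 a) -a3; ring.
have s2 : a * b + b * c + c * a = 1.
  apply: (char2_add_double (K := a) F2); rewrite -[RHS]addr0.
  by rewrite -(mul0r (a ^+ 3 + a ^+ 2 - a - 1)) -a3 /b /c; ring.
have p : a * b * c = 1 by rewrite -a7 /b /c; ring.
(* This sum is only cyclically symmetric: unlike [s1], [s2] and [p], it depends on the order of the
   conjugates. *)
have t : a ^+ 2 * b + b ^+ 2 * c + c ^+ 2 * a = 0.
  have -> : a ^+ 2 * b + b ^+ 2 * c + c ^+ 2 * a
            = a ^+ 4 + a ^+ 7 * a + a ^+ 7 * a ^+ 2.
    by rewrite /b /c; ring.
  by rewrite a7 -s1 /b /c; ring.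
have -> : a ^+ 3 = a * b by rewrite /b; ring.
have -> : b ^+ 2 = c by rewrite /b /c; ring.
have -> : b ^+ 3 = b * c by rewrite /b /c; ring.
have -> : c ^+ 2 = a ^+ 7 * a by rewrite /c; ring.
have -> : c ^+ 3 = a ^+ 7 * (c * a) by rewrite /c; ring.
rewrite a7 !mul1r.
have -> : (h + b * d + a * b * e) * (h + c * d + b * c * e)
          * (h + a * d + c * a * e)
  = h ^+ 3 + a * b * c * d ^+ 3 + (a * b * c) ^+ 2 * e ^+ 3
    + (a + b + c)
      * (h ^+ 2 * d + a * b * c * h * e ^+ 2 + a * b * c * d ^+ 2 * e)
    + (a * b + b * c + c * a)
      * (h ^+ 2 * e + h * d ^+ 2 + a * b * c * d * e ^+ 2)
    + (a ^+ 2 * b + b ^+ 2 * c + c ^+ 2 * a + 3 * (a * b * c)) * (d * e * h).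
  by ring.
rewrite s1 s2 p t; apply: (char2_add_double (K := - (d * e * h)) F2).
by rewrite /cyclic_cubic; ring.
Qed.

Lemma linear_factor_anisotropic (F : fieldType) (s : {rmorphism F -> F})
    (r d : F) :
  2 \in [pchar F] -> (forall x, s (s (s x)) = x) ->
  r ^+ 3 + r + 1 = 0 -> s r = r \/ s r = r ^+ 2 ->
  s (s d) + r ^+ 2 * d + r ^+ 3 * s d = 0 -> d = 0.
Proof.
move=> F2 sK r3 sr L1; have r7 := expr7_of_cubic F2 r3.
have [r_neq0 r_neq1] := cubic_root_neq F2 r3.
have L2 := congr1 s L1; have L3 := congr1 s L2; move: L2 L3.
rewrite !(rmorphD, rmorphM, rmorphXn, rmorph0) /= !sK.
set e := s d in L1 *; set h := s e in L1 *.
have mult_d (k : nat) : r ^+ k * (r - 1) * d = 0 -> d = 0.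
  move/eqP; rewrite !mulf_eq0 subr_eq0 (negbTE r_neq1) expf_eq0.
  by rewrite (negbTE r_neq0) andbF => /eqP.
case: sr => sr; rewrite !sr ?(rmorphXn, sr) /= => L2 L3.
  apply: (mult_d 2%N); apply/esym.
  apply: (char2_add_double (K := (1 + r + r ^+ 2) * e) F2).
  (* These weights cancel e and h modulo 2, r^3 + r + 1 and r^7 - 1. The rewrites below add zero as
     a multiple of each relation, so that [ring] can conclude. *)
  have -> : 0 = - (1 + r ^+ 2) * (h + r ^+ 2 * d + r ^+ 3 * e)
       + r ^+ 4 * (d + r ^+ 2 * e + r ^+ 3 * h)
       + (e + r ^+ 2 * h + r ^+ 3 * d) by rewrite L1 L2 L3; ring.
  rewrite -[RHS]addr0 -[0 in RHS](mul0r ((r ^+ 3 - r ^+ 2 - r - 1) * e)) -r3.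
  by rewrite -[RHS]addr0 -[0 in RHS](mul0r h) -(subrr (r ^+ 7)) {2}r7; ring.
apply: (mult_d 3%N); apply/esym.
have -> : 0 = (h + r ^+ 2 * d + r ^+ 3 * e)
     + r ^+ 4 * (d + (r ^+ 2) ^+ 2 * e + (r ^+ 2) ^+ 3 * h)
     + (e + (r ^+ 2) ^+ 2 ^+ 2 * h + (r ^+ 2) ^+ 2 ^+ 3 * d).
  by rewrite L1 L2 L3; ring.
rewrite -[RHS]addr0 -[0 in RHS](mul0r (r ^+ 2 * d + e + h)) -r3.
rewrite -[RHS]addr0 -[0 in RHS](mul0r (r ^+ 5 * d + r * e + (r ^+ 3 + r) * h)).
by rewrite -(subrr (r ^+ 7)) {2}r7; ring.
Qed.

(** One of the three linear factors vanishes; their parameters a, a^2, a^4 are roots of the same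
    cubic, and [s] fixes or squares all three alike. *)
Lemma cyclic_cubic_anisotropic (F : fieldType) (s : {rmorphism F -> F})
    (a d : F) :
  2 \in [pchar F] -> (forall x, s (s (s x)) = x) ->
  a ^+ 3 + a + 1 = 0 -> s a = a \/ s a = a ^+ 2 ->
  cyclic_cubic d (s d) (s (s d)) = 0 -> d = 0.
Proof.
move=> F2 sK a3 sa; have b3 := cubic_root_square F2 a3.
have c3 := cubic_root_square F2 b3; rewrite -(exprM a 2 2) in c3.
have sX k : s (a ^+ k) = a ^+ k \/ s (a ^+ k) = (a ^+ k) ^+ 2.
  by rewrite rmorphXn /=; case: sa => ->; [left | right; rewrite exprAC].
rewrite (cyclic_cubic_factor _ _ _ F2 a3) => /eqP; rewrite !mulf_eq0 -orbA.
have anis := linear_factor_anisotropic F2 sK.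
by case/or3P=> /eqP; [exact: (anis a) | exact: (anis (a ^+ 2)) |
                      exact: (anis (a ^+ 4))].
Qed.

Lemma quadratic_injective (F : fieldType) (s : {rmorphism F -> F}) (a : F) :
  2 \in [pchar F] -> (forall x, s (s (s x)) = x) ->
  a ^+ 3 + a + 1 = 0 -> s a = a \/ s a = a ^+ 2 ->
  injective (fun u => u * s u + s (s u) ^+ 2 + u ^+ 2 + u + s u).
Proof.
move=> F2 sK a3 sa u v /= uv.
have [d def_u] : exists d, u = v + d by exists (u - v); rewrite addrC subrK.
suff d0 : d = 0 by rewrite def_u d0 addr0.
apply: (cyclic_cubic_anisotropic F2 sK a3 sa); rewrite /cyclic_cubic.
set e := s d; set h := s e; set v1 := s v; set v2 := s v1.
have E1 : v * e + v1 * d + d * e + h ^+ 2 + d ^+ 2 + d + e = 0.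
  apply: (char2_add_double (K := - (v2 * h + v * d)) F2).
  move/eqP: uv; rewrite def_u -subr_eq0 !rmorphD -/e -/v1 -/h -/v2.
  by move/eqP=> <-; ring.
have E2 := congr1 s E1; have E3 := congr1 s E2; move: E2 E3.
rewrite !(rmorphD, rmorphM, rmorphXn, rmorph0) /= !sK -/e -/h -/v1 -/v2.
move=> E2 E3.
apply/esym; apply: (char2_add_double
  (K := v * e * h + v1 * d * h + v2 * d * e + d * h + e * h + d * e
        + d * e * h) F2).
(* With weights h, d, e, each term in [v], [v1] or [v2] occurs twice and so cancels. *)
have -> : 0 = (v * e + v1 * d + d * e + h ^+ 2 + d ^+ 2 + d + e) * h
  + (v1 * h + v2 * e + e * h + d ^+ 2 + e ^+ 2 + e + h) * d
  + (v2 * d + v * h + h * d + e ^+ 2 + h ^+ 2 + h + d) * e.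
  by rewrite E1 E2 E3; ring.
ring.
Qed.

(** * The pentanomial in terms of Frobenius *)

Lemma Frobenius_power (R : comNzRingType) (p m : nat) :
  p \in [pchar R] -> {s : {rmorphism R -> R} | s =1 fun x => x ^+ (p ^ m)}.
Proof.
move=> Rp; elim: m => [|m [s sE]]; first by exists idfun => x; rewrite expr1.
exists (pFrobenius_aut Rp \o s) => x.
by rewrite /= sE pFrobenius_autE -exprM expnSr.
Qed.

Lemma pentanomialE (F : finFieldType) (q : nat) (s : {rmorphism F -> F})
    (x : F) :
  (1 < q)%N -> (s =1 fun y => y ^+ q) -> (forall y, s (s (s y)) = y) ->
  let u := x ^+ (q ^ 2 - q + 1) in
  (pentanomial F q).[x] = u * s u + s (s u) ^+ 2 + u ^+ 2 + u + s u
  /\ x ^+ 2 = u * s u.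
Proof.
move=> q_gt1 sE sK u.
have q_le : (q <= q ^ 2)%N by rewrite -{1}[q]expn1 leq_exp2l.
have q2_le : (q ^ 2 <= q ^ 3)%N by rewrite leq_exp2l.
have s1 : x ^+ q = s x by rewrite sE.
have s2 : x ^+ (q ^ 2) = s (s x) by rewrite !sE -exprM.
have s3 : x ^+ (q ^ 3) = x by rewrite -[RHS]sK !sE -!exprM.
rewrite /pentanomial !(hornerD, hornerXn) -/u.
(* The quotient formula for [u] needs x nonzero; at 0 all exponents are positive. *)
have [x0|x_neq0] := eqVneq x 0.
  have u0 : u = 0 by rewrite /u x0 expr0n addn1.
  rewrite u0 x0 !rmorph0.
  have n0 (n : nat) : (0 < n)%N -> (0 : F) ^+ n = 0.
    by case: n => // n _; rewrite expr0n.
  by rewrite !n0 ?mul0r ?addr0 //; lia.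
set y := s x in s1 s2; set z := s y in s2.
have y_neq0 : y != 0 by rewrite fmorph_eq0.
have z_neq0 : z != 0 by rewrite fmorph_eq0.
have sz : s z = x by rewrite /z /y sK.
have uE : u = x * z / y.
  apply: (canRL (mulfK y_neq0)); rewrite /u -s1 -s2 -exprD -exprS.
  by congr (_ ^+ _); lia.
have suE : s u = x * y / z.
  by rewrite uE !(rmorphM, fmorphV) /= -/y -/z sz (mulrC y).
have ssuE : s (s u) = y * z / x.
  by rewrite suE !(rmorphM, fmorphV) /= -/y -/z sz.
have -> : x ^+ (2 * q ^ 2 + 2 * q - 2) = (y * z / x) ^+ 2.
  rewrite expr_div_n; apply: (canRL (mulfK (expf_neq0 2 x_neq0))).
  rewrite exprMn -s1 -s2 -!exprM -!exprD; congr (_ ^+ _); lia.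
have -> : x ^+ (2 * q ^ 3 + 2 * q ^ 2 - 2 * q) = u ^+ 2.
  rewrite uE expr_div_n; apply: (canRL (mulfK (expf_neq0 2 y_neq0))).
  (* Writing x as x^(q^3) on the right makes the exponents equal as natural numbers. *)
  rewrite exprMn -[in RHS]s3 -s1 -s2 -!exprM -!exprD; congr (_ ^+ _); lia.
have -> : x ^+ (q ^ 3 - q ^ 2 + q) = s u.
  rewrite suE; apply: (canRL (mulfK z_neq0)).
  rewrite -[in RHS]s3 -s1 -s2 -!exprD; congr (_ ^+ _); lia.
by rewrite ssuE suE uE; split; field; rewrite ?x_neq0 ?y_neq0 ?z_neq0.
Qed.

Lemma pchar2_sqr_inj (F : fieldType) :
  2 \in [pchar F] -> injective (fun x : F => x ^+ 2).
Proof. by move=> F2 x y /(fmorph_inj (pFrobenius_aut F2)). Qed.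

(** * Seventh roots of unity and the collision *)

(** Holds because 2^3 = 1 mod 7. *)
Lemma expr7_expn_mod (F : fieldType) (r : F) (m : nat) :
  r ^+ 7 = 1 -> r ^+ (2 ^ m) = r ^+ (2 ^ (m %% 3)).
Proof.
move=> r7; rewrite {1}(divn_eq m 3) expnD exprM; congr (_ ^+ _).
rewrite mulnC expnM; elim: (m %/ 3)%N => // k IHk.
by rewrite expnS exprM exprS r7 mulr1.
Qed.

(* As q = 4 mod 7, Frobenius acts on u as u |-> u ^+ 4, so that
   x ^+ 2 = u ^+ 5 and hence u = x ^+ 6. *)
Lemma pentanomial_expr7 (F : finFieldType) (q : nat) (s : {rmorphism F -> F})
    (x : F) :
  2 \in [pchar F] -> (1 < q)%N -> (s =1 fun y => y ^+ q) ->
  (forall y, s (s (s y)) = y) ->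
  (forall y : F, y ^+ 7 = 1 -> y ^+ q = y ^+ 4) -> x ^+ 7 = 1 ->
  (pentanomial F q).[x] = x ^+ 2 + x ^+ 5 + x ^+ 6.
Proof.
move=> F2 q_gt1 sE sK expq x7; have [-> x2] := pentanomialE x q_gt1 sE sK.
set u := x ^+ (q ^ 2 - q + 1) in x2 *.
have u7 : u ^+ 7 = 1 by rewrite /u exprAC x7 expr1n.
have su : s u = u ^+ 4 by rewrite sE expq.
have uE : u = x ^+ 6.
  rewrite (exprM x 2 3) x2 su -[LHS]mulr1 -(expr1n F 2) -u7; ring.
rewrite su rmorphXn /= su uE.
apply: (char2_add_double (K := x ^+ 3) F2).
have -> : x ^+ 6 * (x ^+ 6) ^+ 4 + ((x ^+ 6) ^+ 4 ^+ 4) ^+ 2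
          + (x ^+ 6) ^+ 2 + x ^+ 6 + (x ^+ 6) ^+ 4
  = (x ^+ 7) ^+ 4 * x ^+ 2 + (x ^+ 7) ^+ 27 * x ^+ 3 + x ^+ 7 * x ^+ 5
    + x ^+ 6 + (x ^+ 7) ^+ 3 * x ^+ 3 by ring.
by rewrite x7 !expr1n; ring.
Qed.

(** On seventh roots of unity f is x^2 + x^5 + x^6, and reducing by a^3 = a + 1 gives the value 1 at
    both points. *)
Lemma pentanomial_collision (F : finFieldType) (q : nat)
    (s : {rmorphism F -> F}) (a : F) :
  2 \in [pchar F] -> (1 < q)%N -> (s =1 fun y => y ^+ q) ->
  (forall y, s (s (s y)) = y) ->
  (forall y : F, y ^+ 7 = 1 -> y ^+ q = y ^+ 4) -> a ^+ 3 + a + 1 = 0 ->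
  (pentanomial F q).[a ^+ 5] = (pentanomial F q).[a ^+ 6].
Proof.
move=> F2 q_gt1 sE sK expq a3; have a7 := expr7_of_cubic F2 a3.
have pE n := pentanomial_expr7 F2 q_gt1 sE sK expq
  (etrans (exprAC a n 7) (etrans (congr1 (fun y => y ^+ n) a7) (expr1n F n))).
rewrite !pE; apply: (char2_add_double (K := - (1 + 2 * a)) F2).
have -> : (a ^+ 5) ^+ 2 + (a ^+ 5) ^+ 5 + (a ^+ 5) ^+ 6
  = a ^+ 7 * a ^+ 3 + (a ^+ 7) ^+ 3 * a ^+ 4 + (a ^+ 7) ^+ 4 * a ^+ 2 by ring.
have -> : (a ^+ 6) ^+ 2 + (a ^+ 6) ^+ 5 + (a ^+ 6) ^+ 6
  = a ^+ 7 * a ^+ 5 + (a ^+ 7) ^+ 4 * a ^+ 2 + (a ^+ 7) ^+ 5 * a by ring.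
rewrite a7 !expr1n -[LHS]addr0 -(mul0r (a ^+ 2 - a - 2)) -a3; ring.
Qed.
Local Close Scope ring_scope.

Theorem theorem3p6 (m q : nat) (F : finFieldType) (hm : 0 < m)
    (hq : q = 2 ^ m) (hF : #|F| = q ^ 3) :
  permutation_poly (pentanomial F q) <-> m <> 2 %[mod 3].
Proof.
have F2 : 2 \in [pchar F]%R.
  by apply: (@card_finPcharP _ _ (m * 3)); rewrite // hF hq expnM.
have [a a3] : exists a : F, (a ^+ 3 + a + 1 = 0)%R.
  by apply: (@cubic_root_exists _ m F2); rewrite hF hq.
have a7 := expr7_of_cubic F2 a3.
have [s sE] := Frobenius_power m F2; rewrite -hq in sE.
have sK x : s (s (s x)) = x by rewrite !sE -!exprM -[RHS]expf_card hF.
have q_gt1 : 1 < q by rewrite hq -{1}(expn0 2) ltn_exp2l.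
split=> [/bij_inj f_inj m2|m2].
  have expq (y : F) : (y ^+ 7 = 1)%R -> (y ^+ q = y ^+ 4)%R.
    by move=> y7; rewrite hq (expr7_expn_mod m y7) m2.
  have /f_inj/eqP := pentanomial_collision F2 q_gt1 sE sK expq a3.
  have [a_neq0 a_neq1] := cubic_root_neq F2 a3.
  rewrite -subr_eq0 (_ : (_ - _ = a ^+ 5 * (1 - a))%R); last by ring.
  by rewrite mulf_eq0 expf_eq0 (negbTE a_neq0) subr_eq0 eq_sym (negbTE a_neq1).
(* [s] raises a to the power 2^(m mod 3), which is 1 or 2 here. *)
have sa : (s a = a \/ s a = a ^+ 2)%R.
  rewrite sE hq (expr7_expn_mod m a7); have := ltn_pmod m (isT : 0 < 3).
  by case: (m %% 3) m2 => [|[|[|]]] //; [left | right].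
apply: injF_bij => x y /=.
have [-> x2] := pentanomialE x q_gt1 sE sK.
have [-> y2] := pentanomialE y q_gt1 sE sK.
move/(quadratic_injective F2 sK a3 sa) => uv.
by apply: (pchar2_sqr_inj F2); rewrite x2 uv -y2.
Qed.
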